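(* There is an absolute constant $c>0$ such that the following hold. (i) For every $\alpha\in[1/2,2]$ and every integer $N\geq 10$ there exists a uniformly convex sequence $\{a_n\}_{n=1}^N$ (with parameter $N$) such that $|\{a_n\}_{n=1}^N\cap N^{-\alpha}\mathbb{Z}|\geq c N^{\frac{\alpha+1}{3}}$. (ii) For every $\alpha\in[0,1/2]$ and every integer $N\geq 10$ there exists a uniformly convex sequence $\{a_n\}_{n=1}^N$ (with parameter $N$) such that $|\{a_n\}_{n=1}^N\cap N^{-\alpha}\mathbb{Z}|\geq c N^{\alpha}$. (iii) Conversely, for every $\epsilon>0$ there exists $C_\epsilon>0$ such that for every integer $N\geq 1$, every uniformly convex sequence $\{a_n\}_{n=1}^N$ (with parameter $N$) and every $\alpha\in[0,2]$, \[ |\{a_n\}_{n=1}^N\cap N^{-\alpha}\mathbb{Z}| \leq \begin{cases} C_\epsilon N^\epsilon N^{\frac{\alpha+1}{3}} & \text{if } \alpha\in[\frac12,2],\\ 100 N^{\alpha} & \text{if } \alpha\in[0,\frac12].\end{cases} \]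
   Context: A real sequence $\{a_n\}_{n=1}^N$ is called uniformly convex (with parameter $N$) if for all admissible $n$: $a_{n+1}-a_n\in[\frac{1}{4N},\frac{4}{N}]$ and $(a_{n+2}-a_{n+1})-(a_{n+1}-a_n)\in[\frac{1}{4N^2},\frac{4}{N^2}]$. $|\cdot|$ denotes cardinality of a set; $\{a_n\}_{n=1}^N$ is viewed as the set of its values. *)

(* Defs.v *)
From mathcomp Require Import all_boot all_order all_algebra.
From mathcomp Require Import all_classical all_reals all_analysis.
Set Implicit Arguments. Unset Strict Implicit. Unset Printing Implicit Defensive.
Import Order.TTheory GRing.Theory Num.Theory.
Local Open Scope ring_scope.

Definition uniformly_convex (R : realType) (N : nat) (a : nat -> R) : Prop :=
  (forall n : nat, (1 <= n)%N -> (n.+1 <= N)%N ->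
     1 / (4 * N%:R) <= a n.+1 - a n <= 4 / N%:R) /\
  (forall n : nat, (1 <= n)%N -> (n.+2 <= N)%N ->
     1 / (4 * N%:R ^+ 2) <= (a n.+2 - a n.+1) - (a n.+1 - a n) <= 4 / N%:R ^+ 2).

Definition in_lattice (R : realType) (N : nat) (alpha : R) (x : R) : Prop :=
  exists k : int, x = k%:~R * (N%:R `^ (- alpha)).

Definition lattice_count (R : realType) (N : nat) (a : nat -> R) (alpha : R) : nat :=
  size (undup [seq a n | n <- iota 1 N & `[< in_lattice N alpha (a n) >]]).

(* Main.v *)
(** Upper bound: the vectors joining consecutive lattice points on the graph have strictly increasing
    slopes, so they are distinct. At most PQ of them have both coordinates below P and Q, and by
    Markov's inequality at most N/P (resp. 4 N^alpha/Q) have a first (second) coordinate above P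
    (resp. Q); P = N^((2-alpha)/3), Q = N^((2 alpha-1)/3) balances the three terms.

    Lower bound: start from the parabola m/N + m^2/(2N^2) and cut the indices into blocks. Adding to
    it a small quadratic spline in each block keeps it uniformly convex and moves one term of the
    block by up to L^2/(2N^2), L being comparable to the block length. If N^(2 alpha - 1) is bounded,
    blocks of length about N^(1-alpha) suffice, since the parabola crosses a lattice point in each of
    them. Otherwise take blocks of length about T = N^((2-alpha)/3). By Dirichlet the tangent slope in
    a block, in lattice units, is within 1/(pT) of some q/p with p <= T, and when p > T/64 the block
    contains a term close enough to the lattice; counting rationals of denominator at most T/64 shows
    that this fails for at most a fixed proportion of the blocks. *)

Require Import Defs.
From mathcomp Require Import all_boot all_order all_algebra.
From mathcomp Require Import all_classical all_reals all_analysis.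
From mathcomp Require Import zify ring lra.
Import Order.TTheory GRing.Theory Num.Theory.
Set Implicit Arguments.
Unset Strict Implicit.
Local Open Scope ring_scope.

(** * Increments and chords of uniformly convex sequences *)

Lemma convex_increments_lt (R : realType) (N : nat) (a : nat -> R) (m n : nat) :
  uniformly_convex N a -> (1 <= m)%N -> (m < n)%N -> (n < N)%N ->
  a m.+1 - a m < a n.+1 - a n.
Proof.
move=> [_ a2] m1 mn nN; have N0 : 0 < N%:R :> R by rewrite ltr0n; lia.
have step k : (1 <= k)%N -> (k.+1 < N)%N -> a k.+1 - a k < a k.+2 - a k.+1.
  move=> k1 kN; have /andP[+ _] := a2 k k1 kN.
  by rewrite -subr_gt0; apply: lt_le_trans; rewrite divr_gt0// mulr_gt0// exprn_gt0.
rewrite -(subnKC mn) in nN *; elim: (n - m.+1)%N nN => [|d IH] dN.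
  by rewrite addn0; apply: step => //; lia.
apply: lt_trans (IH _) _; first lia.
by rewrite addnS; apply: step; lia.
Qed.

Lemma convex_increments_le (R : realType) (N : nat) (a : nat -> R) (m n : nat) :
  uniformly_convex N a -> (1 <= m)%N -> (m <= n)%N -> (n < N)%N ->
  a m.+1 - a m <= a n.+1 - a n.
Proof.
move=> ac m1; rewrite leq_eqVlt => /orP[/eqP-> //|mn] nN.
exact: ltW (convex_increments_lt ac m1 mn nN).
Qed.

Lemma convex_chord_bounds (R : realType) (N : nat) (a : nat -> R) (m d : nat) :
  uniformly_convex N a -> (1 <= m)%N -> (m + d < N)%N ->
  d.+1%:R * (a m.+1 - a m) <= a (m + d.+1)%N - a m
    <= d.+1%:R * (a (m + d.+1)%N - a (m + d)%N).
Proof.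
move=> ac m1; elim: d => [|d IH] dN; first by rewrite addn0 addn1 !mul1r lexx.
have /andP[lo hi] := IH (ltn_trans (ltnSn _) (eq_ind _ (fun k => (k < N)%N) dN _ (addnS _ _))).
have h1 : a m.+1 - a m <= a (m + d.+2)%N - a (m + d.+1)%N.
  by rewrite [(m + d.+2)%N]addnS; apply: (convex_increments_le ac) => //; lia.
have h2 : a (m + d.+1)%N - a (m + d)%N <= a (m + d.+2)%N - a (m + d.+1)%N.
  by rewrite [(m + d.+2)%N]addnS {1}addnS; apply: (convex_increments_le ac) => //; lia.
have := ler_wpM2l (ler0n R d.+1) h2.
rewrite -[d.+2%:R]natr1 !mulrDl !mul1r; lra.
Qed.

(** A chord slope is an average of increments, and the last increment of the left chord is smaller
    than the first increment of the right one. The two chords may share the endpoint [m' = n]. *)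
Lemma convex_chord_slopes (R : realType) (N : nat) (a : nat -> R) (m m' n n' : nat) :
  uniformly_convex N a -> (1 <= m)%N -> (m < m')%N -> (m' <= n)%N ->
  (n < n')%N -> (n' <= N)%N ->
  (a m' - a m) / (m' - m)%:R < (a n' - a n) / (n' - n)%:R.
Proof.
move=> ac m1 mm' m'n nn' n'N.
have [d dE] : exists d, m' = (m + d.+1)%N by exists (m' - m).-1; lia.
have [e eE] : exists e, n' = (n + e.+1)%N by exists (n' - n).-1; lia.
subst m' n'; rewrite !addKn.
have /andP[_ hi] := @convex_chord_bounds R N a m d ac m1 ltac:(lia).
have /andP[lo _] := @convex_chord_bounds R N a n e ac ltac:(lia) ltac:(lia).
rewrite ltr_pdivrMr// (le_lt_trans hi)// mulrC ltr_pM2r//.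
apply: lt_le_trans (_ : a n.+1 - a n <= _); last by rewrite ler_pdivlMr// mulrC.
by rewrite addnS; apply: (convex_increments_lt ac); lia.
Qed.

Lemma convex_length (R : realType) (N : nat) (a : nat -> R) (m n : nat) :
  uniformly_convex N a -> (1 <= m)%N -> (m < n)%N -> (n <= N)%N ->
  0 < a n - a m <= 4.
Proof.
move=> [a1 _] m1 mn nN; have N0 : 0 < N%:R :> R by rewrite ltr0n; lia.
have step k : (1 <= k)%N -> (k < N)%N -> 0 < a k.+1 - a k <= 4 / N%:R.
  move=> k1 kN; have /andP[+ ->] := a1 k k1 kN; rewrite andbT.
  by apply: lt_le_trans; rewrite divr_gt0// mulr_gt0.
suff H d : (m + d < N)%N -> 0 < a (m + d.+1)%N - a m <= d.+1%:R * (4 / N%:R).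
  have := H (n - m.+1)%N ltac:(lia).
  rewrite addnS -addSn (subnKC mn) => /andP[-> /=] /le_trans; apply.
  by rewrite mulrCA -[leRHS]mulr1 ler_pM2l// ler_pdivrMr// mul1r ler_nat; lia.
elim: d => [|d IH] dN; first by rewrite addn1 mul1r; apply: step => //; lia.
have /andP[lo hi] := IH ltac:(lia).
have /andP[lo' hi'] := step (m + d.+1)%N ltac:(lia) ltac:(lia).
rewrite addnS -[d.+2%:R]natr1 mulrDl mul1r; apply/andP; split; lra.
Qed.

Lemma convex_inj (R : realType) (N : nat) (a : nat -> R) :
  uniformly_convex N a -> {in iota 1 N &, injective a}.
Proof.
move=> ac m n; rewrite !mem_iota => /andP[m1 mN] /andP[n1 nN] E.
case: (ltngtP m n) => // h.
  by have /andP[] := @convex_length R N a m n ac m1 h ltac:(lia); rewrite E subrr ltxx.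
by have /andP[] := @convex_length R N a n m ac n1 h ltac:(lia); rewrite E subrr ltxx.
Qed.

(** The sequence is strictly increasing, so [undup] removes nothing and indices can be counted
    instead of values. *)
Lemma lattice_countE (R : realType) (N : nat) (a : nat -> R) (alpha : R) :
  uniformly_convex N a ->
  lattice_count N a alpha = count (fun n => `[< in_lattice N alpha (a n) >]) (iota 1 N).
Proof.
move=> ac; rewrite /lattice_count undup_id ?size_map ?size_filter//.
rewrite map_inj_in_uniq ?filter_uniq ?iota_uniq// => m n.
by rewrite !mem_filter => /andP[_ m1] /andP[_ n1]; apply: (convex_inj ac).
Qed.

(** * Upper bounds by counting *)

Lemma choice_in (A B : Type) (b : B) (D : A -> Prop) (P : A -> B -> Prop) :
  (forall x, D x -> exists y, P x y) -> exists f, forall x, D x -> P x (f x).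
Proof.
move=> h; suff /choice[f fP] : forall x, exists y, D x -> P x y by exists f.
by move=> x; have [/h[y yP]|nD] := pselect (D x); [exists y|exists b].
Qed.

Lemma count_markov (R : realType) (s : seq nat) (f : nat -> nat) (P A : R) :
  0 < P -> \sum_(i <- s) (f i)%:R <= A ->
  (count (fun i => P < (f i)%:R) s)%:R <= A / P.
Proof.
move=> P0 hA; rewrite ler_pdivlMr//; apply: le_trans hA.
elim: s => [|i s IH]; first by rewrite big_nil mul0r.
rewrite big_cons /= natrD mulrDl lerD//.
by case: ltrP => [/ltW|_]; rewrite ?mul1r ?mul0r.
Qed.

(** The pairs embed in a box of integer points. Since both coordinates are positive, the box starts
    at 1 and has at most [P * Q] points, with no additive loss. *)
Lemma size_bounded_pairs (R : realType) (s : seq nat) (p q : nat -> nat) (P Q : R) :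
  0 <= P -> 0 <= Q -> uniq s -> {in s &, injective (fun i => (p i, q i))} ->
  {in s, forall i, (0 < p i)%N && (0 < q i)%N} ->
  {in s, forall i, (p i)%:R <= P /\ (q i)%:R <= Q} ->
  (size s)%:R <= P * Q.
Proof.
move=> P0 Q0 us inj pos bd.
pose L := [seq (x, y) | x <- iota 1 (Num.truncn P), y <- iota 1 (Num.truncn Q)].
have : (size [seq (p i, q i) | i <- s] <= size L)%N.
  apply: uniq_leq_size; first by rewrite map_inj_in_uniq.
  move=> _ /mapP[i si ->]; have /andP[p0 q0] := pos i si; have [pP qQ] := bd i si.
  by apply: allpairs_f; rewrite mem_iota add1n ltnS ?p0 ?q0 truncn_ge_nat.
rewrite size_map size_allpairs !size_iota -(ler_nat R) natrM => /le_trans; apply.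
by apply: ler_pM; rewrite ?ler0n// truncn_le.
Qed.

Lemma count_distinct_pairs (R : realType) (k : nat) (p q : nat -> nat) (A B P Q : R) :
  0 < P -> 0 < Q ->
  {in iota 0 k &, injective (fun i => (p i, q i))} ->
  {in iota 0 k, forall i, (0 < p i)%N && (0 < q i)%N} ->
  \sum_(i <- iota 0 k) (p i)%:R <= A ->
  \sum_(i <- iota 0 k) (q i)%:R <= B ->
  k%:R <= P * Q + A / P + B / Q.
Proof.
move=> P0 Q0 inj pos hA hB.
pose c i := ((p i)%:R <= P) && ((q i)%:R <= Q).
have split_count s : (size s <= count c s + count (fun i => (P < (p i)%:R)%R) s
    + count (fun i => (Q < (q i)%:R)%R) s)%N.
  elim: s => //= i s IH; rewrite [c i]/c; case: (lerP _ P); case: (lerP _ Q); lia.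
have := split_count (iota 0 k); rewrite size_iota -(ler_nat R) !natrD => /le_trans; apply.
rewrite !lerD ?count_markov// -size_filter.
have sub i : i \in [seq i <- iota 0 k | c i] -> i \in iota 0 k by rewrite mem_filter => /andP[].
apply: (size_bounded_pairs (p := p) (q := q)); rewrite ?filter_uniq ?iota_uniq ?ltW//.
- by move=> i j /sub i1 /sub j1; apply: inj.
- by move=> i /sub; apply: pos.
- by move=> i; rewrite mem_filter => /andP[/andP[]].
Qed.

(* Consecutive points n < n' of S give pairs (n' - n, X (a n' - a n)) of positive integers; they are
   distinct because the chord slopes increase strictly. *)
Lemma convex_count_le (R : realType) (N : nat) (a : nat -> R) (X P Q : R) (S : pred nat) :
  uniformly_convex N a -> 0 < X -> 0 < P -> 0 < Q ->
  (forall n, S n -> exists k : int, X * a n = k%:~R) ->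
  (count S (iota 1 N))%:R <= P * Q + N%:R / P + 4 * X / Q + 1.
Proof.
move=> ac X0 P0 Q0 hS; rewrite -size_filter; set s := [seq n <- _ | S n].
have [->|sn] := posnP (size s).
  by rewrite !addr_ge0 ?divr_ge0 ?mulr_ge0 ?ler01 ?ler0n// ltW.
have s_sorted : sorted ltn s by rewrite sorted_filter ?iota_ltn_sorted//; exact: ltn_trans.
pose n i := nth 0%N s i.
have n_lt i j : (i < j)%N -> (j < size s)%N -> (n i < n j)%N.
  by move=> ij js; rewrite /n (sorted_ltn_nth ltn_trans)// inE; lia.
have n_in i : (i < size s)%N -> S (n i) /\ (1 <= n i <= N)%N.
  move=> /(mem_nth 0%N); rewrite mem_filter mem_iota => /andP[Si /andP[h1 h2]].
  by split=> //; rewrite h1 -ltnS.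
have [z zE] : exists z : nat -> int, forall i, (i < size s)%N -> X * a (n i) = (z i)%:~R.
  apply: (choice_in (0 : int) (D := fun i => (i < size s)%N) (P := fun i k => X * a (n i) = k%:~R)) => i h.
  exact: hS (n_in i h).1.
have z_lt i : (i.+1 < size s)%N -> z i < z i.+1.
  move=> h; rewrite -(ltr_int R) -!zE//; last lia.
  rewrite ltr_pM2l// -subr_gt0.
  have [_ /andP[l1 _]] := n_in i (ltnW h); have [_ /andP[_ u1]] := n_in i.+1 h.
  by have /andP[] := convex_length ac l1 (n_lt _ _ (ltnSn i) h) u1.
pose p i := (n i.+1 - n i)%N; pose q i := `|z i.+1 - z i|%N.
have pE i : (i.+1 < size s)%N -> (p i)%:R = (n i.+1)%:R - (n i)%:R :> R.
  by move=> h; rewrite /p natrB// ltnW// n_lt.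
have qE i : (i.+1 < size s)%N -> (q i)%:R = X * a (n i.+1) - X * a (n i).
  move=> h; rewrite !zE//; last lia.
  by rewrite -intrB /q natr_absz gtr0_norm// subr_gt0 z_lt.
have slope_lt i j : (i < j)%N -> (j.+1 < size s)%N ->
    (q i)%:R / (p i)%:R < (q j)%:R / (p j)%:R :> R.
  move=> ij js; have is' : (i.+1 < size s)%N by lia.
  rewrite !qE// -!mulrBr -!mulrA ltr_pM2l//.
  have [_ /andP[l1 _]] := n_in i ltac:(lia); have [_ /andP[_ u1]] := n_in j.+1 js.
  apply: (convex_chord_slopes ac) => //; try exact: n_lt.
  by case: (ltngtP i.+1 j) => h; [apply/ltnW/n_lt; lia|lia|rewrite h].
have in_k i : i \in iota 0 (size s).-1 -> (i.+1 < size s)%N by rewrite mem_iota; lia.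
(* There is one pair fewer than there are points, hence the final summand 1 of the bound. Both
   coordinate sums telescope, to at most [N] and, by [convex_length], to at most [4 * X]. *)
have main : (size s).-1%:R <= P * Q + N%:R / P + 4 * X / Q.
  apply: (count_distinct_pairs (p := p) (q := q)) => //.
  - move=> i j /in_k ik /in_k jk [pij qij].
    case: (ltngtP i j) => // h.
      by have := slope_lt i j h jk; rewrite pij qij ltxx.
    by have := slope_lt j i h ik; rewrite pij qij ltxx.
  - by move=> i /in_k ik; rewrite /p subn_gt0 n_lt//= /q absz_gt0 subr_eq0 gt_eqF// z_lt.
  - rewrite (eq_big_seq (fun i => (n i.+1)%:R - (n i)%:R)) => [|i /in_k]; last exact: pE.
    rewrite -[X in iota 0 X]subn0 -/(index_iota 0 _) telescope_sumr//.
    have [_ /andP[_ h]] := n_in (size s).-1 ltac:(lia).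
    by rewrite lerBlDr -natrD ler_nat; lia.
  - rewrite (eq_big_seq (fun i => X * a (n i.+1) - X * a (n i))) => [|i /in_k]; last exact: qE.
    rewrite -[X in iota 0 X]subn0 -/(index_iota 0 _) (telescope_sumr (fun i => X * a (n i)))//.
    rewrite -mulrBr mulrC ler_pM2r//.
    case: (posnP (size s).-1) => [->|h]; first by rewrite subrr.
    have [_ /andP[_ u]] := n_in (size s).-1 ltac:(lia).
    have [_ /andP[l _]] := n_in 0%N sn.
    by have /andP[] := convex_length ac l (n_lt _ _ h ltac:(lia)) u.
by rewrite -(prednK sn) -natr1 lerD2r.
Qed.

(** The integers [X * a n] are distinct and lie within [4 * X] of the first of them. This serves the
    range of [alpha] up to 1/2. *)
Lemma convex_count_le_length (R : realType) (N : nat) (a : nat -> R) (X : R) (S : pred nat) :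
  uniformly_convex N a -> 0 < X ->
  (forall n, S n -> exists k : int, X * a n = k%:~R) ->
  (count S (iota 1 N))%:R <= 4 * X + 1.
Proof.
move=> ac X0 hS; case: (posnP N) => [->|N0]; first by rewrite /=; lra.
have [z zE] : exists z : nat -> int, forall i, S i -> X * a i = (z i)%:~R.
  exact: (choice_in (0 : int) (D := S) (P := fun i k => X * a i = k%:~R)).
rewrite -size_filter; set s := [seq n <- _ | S n].
case sE : s => [|m s']; first by rewrite /=; lra.
have s_in i : i \in s -> [/\ S i, (1 <= i)%N & (i <= N)%N].
  by rewrite mem_filter mem_iota => /andP[-> /andP[h1 h2]]; split=> //; lia.
have s_sorted : sorted ltn s by rewrite sorted_filter ?iota_ltn_sorted//; exact: ltn_trans.
have ms : m \in s by rewrite sE mem_head.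
have [Sm m1 mN] := s_in m ms.
have min_m i : i \in s -> (m <= i)%N.
  move: s_sorted; rewrite sE /= => /(order_path_min ltn_trans)/allP h.
  by rewrite inE => /orP[/eqP->//|/h /ltnW].
have bd i : i \in s -> 0 <= z i - z m /\ (z i - z m)%:~R <= 4 * X.
  move=> si; have [Si i1 iN] := s_in i si.
  rewrite -(ler_int R) intrB -!zE// -mulrBr.
  have := min_m i si; rewrite leq_eqVlt => /orP[/eqP<-|mi].
    by rewrite subrr mulr0; split=> //; rewrite mulr_ge0// ltW.
  have /andP[lo hi] := convex_length ac m1 mi iN; split.
    by rewrite mulr_ge0 ?ltW.
  by rewrite mulrC ler_pM2r.
rewrite -sE.
have : (size [seq `|z i - z m|%N | i <- s] <= size (iota 0 (Num.truncn (4 * X)).+1))%N.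
  apply: uniq_leq_size.
    rewrite map_inj_in_uniq ?filter_uniq ?iota_uniq// => i j si sj E.
    have [Si i1 iN] := s_in i si; have [Sj j1 jN] := s_in j sj.
    have [zi _] := bd i si; have [zj _] := bd j sj.
    apply: (convex_inj ac); rewrite ?mem_iota; try lia.
    by apply: (mulfI (lt0r_neq0 X0)); rewrite !zE//; congr (_%:~R); lia.
  move=> _ /mapP[i si ->]; have [zi zX] := bd i si.
  rewrite mem_iota /= add0n ltnS truncn_ge_nat ?(mulr_ge0 _ (ltW X0))//.
  by rewrite natr_absz ger0_norm.
rewrite size_map size_iota -(ler_nat R) => /le_trans; apply.
by rewrite -natr1 lerD2r truncn_le mulr_ge0// ltW.
Qed.

(** * Perturbing a parabola by splines *)

(** Its second difference is exactly 1/N^2, and its increments lie between 1/N and 2/N for [m < N];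
    this leaves room for perturbations inside the convexity constraints. Indices start at 0 here, so
    term [n] of a sequence is read at [n.-1]. *)
Definition parabola (R : realType) (N m : nat) : R :=
  m%:R / N%:R + m%:R ^+ 2 / (2 * N%:R ^+ 2).

(* Second differences +1, -1, -1, +1 on four consecutive runs of length L starting at u;
   truncated subtraction supplies the cut-offs. *)
Definition spline (R : realType) (L u m : nat) : R :=
  'C(m - u, 2)%:R - 2 * 'C(m - (u + L), 2)%:R
  + 2 * 'C(m - (u + 3 * L), 2)%:R - 'C(m - (u + 4 * L), 2)%:R.

(** A zigzag: it climbs to L at u + L, descends to -L at u + 3L and is back to 0 at u + 4L. *)
Definition spline_step (R : realType) (L u m : nat) : R :=
  (m - u)%N%:R - 2 * (m - (u + L))%N%:R
  + 2 * (m - (u + 3 * L))%N%:R - (m - (u + 4 * L))%N%:R.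

Lemma parabola_step (R : realType) (N m : nat) : (0 < N)%N ->
  parabola R N m.+1 - parabola R N m = 1 / N%:R + (2 * m%:R + 1) / (2 * N%:R ^+ 2).
Proof.
move=> N0; rewrite /parabola -natr1; field.
by rewrite pnatr_eq0 -lt0n.
Qed.

Lemma bin2_natr (R : realType) (n : nat) : 'C(n, 2)%:R = n%:R * (n%:R - 1) / 2 :> R.
Proof.
elim: n => [|n IH]; first by rewrite mul0r mul0r.
by rewrite binS bin1 natrD IH -natr1; field.
Qed.

Lemma bin2_subS (m u : nat) : ('C(m.+1 - u, 2) = 'C(m - u, 2) + (m - u))%N.
Proof.
case: (leqP u m) => h; first by rewrite subSn// binS bin1.
have -> : (m - u = 0)%N by lia.
by have : (m.+1 - u <= 1)%N by [lia]; case: (m.+1 - u)%N => [|[]].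
Qed.

Lemma spline_stepE (R : realType) (L u m : nat) :
  spline R L u m.+1 - spline R L u m = spline_step R L u m.
Proof. by rewrite /spline /spline_step !bin2_subS !natrD; ring. Qed.

(** The zigzag of first differences changes sign at the midpoint, so this is where a given
    coefficient displaces the parabola most. *)
Lemma spline_peak (R : realType) (L u : nat) : spline R L u (u + 2 * L) = L%:R ^+ 2.
Proof.
rewrite /spline.
have -> : (u + 2 * L - u = 2 * L)%N by lia.
have -> : (u + 2 * L - (u + L) = L)%N by lia.
have -> : (u + 2 * L - (u + 3 * L) = 0)%N by lia.
have -> : (u + 2 * L - (u + 4 * L) = 0)%N by lia.
by rewrite !bin2_natr !natrM; field.
Qed.

(** Past the support, the second differences +1, -1, -1, +1 have zero sum and, by symmetry, zero
    first moment. *)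
Lemma spline_outside (R : realType) (L u m : nat) :
  ~~ (u <= m < u + 4 * L)%N -> spline R L u m = 0.
Proof.
rewrite negb_and -!leqNgt -ltnNge => /orP[h|h]; rewrite /spline.
  have -> : (m - u = 0)%N by lia.
  have -> : (m - (u + L) = 0)%N by lia.
  have -> : (m - (u + 3 * L) = 0)%N by lia.
  have -> : (m - (u + 4 * L) = 0)%N by lia.
  by rewrite bin0n /=; ring.
rewrite -(subnKC h); set d := (m - _)%N.
have -> : (u + 4 * L + d - u = 4 * L + d)%N by lia.
have -> : (u + 4 * L + d - (u + L) = 3 * L + d)%N by lia.
have -> : (u + 4 * L + d - (u + 3 * L) = L + d)%N by lia.
have -> : (u + 4 * L + d - (u + 4 * L) = d)%N by lia.
by rewrite !bin2_natr !natrD /=; field.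
Qed.

Lemma spline_step_outside (R : realType) (L u m : nat) :
  ~~ (u <= m < u + 4 * L)%N -> spline_step R L u m = 0.
Proof.
move=> h; rewrite /spline_step.
have : (m - u + 2 * (m - (u + 3 * L)) = 2 * (m - (u + L)) + (m - (u + 4 * L)))%N by lia.
move=> /eqP; rewrite -(eqr_nat R) !(natrM, natrD) => /eqP E; lra.
Qed.

Lemma spline_step_norm (R : realType) (L u m : nat) : `|spline_step R L u m| <= L%:R.
Proof.
have h1 : (m - u + 2 * (m - (u + 3 * L)) <= 2 * (m - (u + L)) + (m - (u + 4 * L)) + L)%N by lia.
have h2 : (2 * (m - (u + L)) + (m - (u + 4 * L)) <= m - u + 2 * (m - (u + 3 * L)) + L)%N by lia.
move: h1 h2; rewrite -!(ler_nat R) !(natrM, natrD) ler_norml /spline_step => h1 h2.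
by apply/andP; split; lra.
Qed.

Lemma spline_step2_norm (R : realType) (L u m : nat) :
  `|spline_step R L u m.+1 - spline_step R L u m| <= 1.
Proof.
have h1 : (m.+1 - u + 2 * (m.+1 - (u + 3 * L)) + 2 * (m - (u + L)) + (m - (u + 4 * L)) <=
  m - u + 2 * (m - (u + 3 * L)) + 2 * (m.+1 - (u + L)) + (m.+1 - (u + 4 * L)) + 1)%N by lia.
have h2 : (m - u + 2 * (m - (u + 3 * L)) + 2 * (m.+1 - (u + L)) + (m.+1 - (u + 4 * L)) <=
  m.+1 - u + 2 * (m.+1 - (u + 3 * L)) + 2 * (m - (u + L)) + (m - (u + 4 * L)) + 1)%N by lia.
move: h1 h2; rewrite -!(ler_nat R) !(natrM, natrD) ler_norml /spline_step => h1 h2.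
by apply/andP; split; lra.
Qed.

Lemma spline_step2_outside (R : realType) (L u m : nat) :
  ~~ (u <= m < u + 4 * L)%N -> spline_step R L u m.+1 - spline_step R L u m = 0.
Proof.
move=> h; rewrite (spline_step_outside _ h) subr0.
(* For [m = u - 1] the index [m.+1] is already in the support, but the step at [u] still
   vanishes. *)
case: (ltnP m u) => mu; last by apply: spline_step_outside; lia.
by rewrite /spline_step; do 4 (rewrite (_ : (m.+1 - _ = 0)%N); last lia); ring.
Qed.

Lemma sum_iota_single (R : realType) (K j : nat) (F : nat -> R) :
  (forall i, (i < K)%N -> i != j -> F i = 0) ->
  \sum_(i <- iota 0 K) F i = if (j < K)%N then F j else 0.
Proof.
move=> F0; case: ifP => jK.
  rewrite (bigD1_seq j) ?iota_uniq ?mem_iota//= big_seq_cond big1 ?addr0// => i.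
  by rewrite mem_iota => /andP[/andP[_ ?] /F0->].
rewrite big_seq big1// => i; rewrite mem_iota => /andP[_ iK].
by apply: F0 => //; apply: contraFneq jK => <-.
Qed.

(** The blocks [M i, M (i + 1)) are disjoint, so only the summand [i = m %/ M] can be nonzero. *)
Lemma block_sum_norm (R : realType) (K M m : nat) (F : nat -> R) (e : R) :
  0 <= e -> (0 < M)%N ->
  (forall i, (i < K)%N -> `|F i| <= e) ->
  (forall i, (i < K)%N -> ~~ (M * i <= m < M * i.+1)%N -> F i = 0) ->
  `|\sum_(i <- iota 0 K) F i| <= e.
Proof.
move=> e0 M0 Fe F0; rewrite (sum_iota_single (j := (m %/ M)%N)).
  by case: ifP => [/Fe//|_]; rewrite normr0.
move=> i iK im; apply: F0 => //; apply: contra im => /andP[h1 h2]; apply/eqP; nia.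
Qed.

(** At each index at most one spline acts. It changes an increment by at most L/(2N^2), hence by at
    most 1/(2N), and a second difference by at most 1/(2N^2). The position [u i] is constrained only
    when [h i] is nonzero, so blocks without a suitable term may carry an arbitrary [u i]. *)
Lemma perturbed_parabola_convex (R : realType) (N K L M : nat) (h : nat -> R) (u : nat -> nat) :
  (0 < N)%N -> (L <= N)%N -> (0 < M)%N ->
  (forall i, (i < K)%N -> h i != 0 -> (M * i <= u i)%N /\ (u i + 4 * L <= M * i.+1)%N) ->
  (forall i, (i < K)%N -> `|h i| <= 1 / (2 * N%:R ^+ 2)) ->
  uniformly_convex N (fun n => parabola R N n.-1 +
    \sum_(i <- iota 0 K) h i * spline R L (u i) n.-1).
Proof.
move=> N0 LN M0 hu hh.
have NR : 0 < N%:R :> R by rewrite ltr0n.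
pose v : R := N%:R^-1; have v0 : 0 < v by rewrite invr_gt0.
have Nv : N%:R * v = 1 by rewrite mulfV// lt0r_neq0.
have e1 : 1 / (2 * N%:R ^+ 2) = v ^+ 2 / 2 :> R by rewrite /v; field; rewrite lt0r_neq0.
have zero i m (f : nat -> nat -> nat -> R) : (i < K)%N ->
    (~~ (u i <= m < u i + 4 * L)%N -> f L (u i) m = 0) ->
    ~~ (M * i <= m < M * i.+1)%N -> h i * f L (u i) m = 0.
  move=> iK f0 im; case: (eqVneq (h i) 0) => [->|/(hu i iK)[h1 h2]]; first by rewrite mul0r.
  by rewrite f0 ?mulr0//; apply: contra im => /andP[? ?]; apply/andP; split; lia.
have S1 m : `|\sum_(i <- iota 0 K) h i * spline_step R L (u i) m| <= v ^+ 2 / 2 * L%:R.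
  apply: (block_sum_norm (M := M) (m := m)) => // [|i iK|i iK].
  - by rewrite mulr_ge0// divr_ge0// exprn_ge0// ltW.
  - by rewrite normrM ler_pM// ?spline_step_norm// -e1 hh.
  - by apply: zero => //; apply: spline_step_outside.
have S2 m : `|\sum_(i <- iota 0 K) h i *
    (spline_step R L (u i) m.+1 - spline_step R L (u i) m)| <= v ^+ 2 / 2.
  apply: (block_sum_norm (M := M) (m := m)) => // [|i iK|i iK].
  - by rewrite divr_ge0// exprn_ge0// ltW.
  - by rewrite normrM -[leRHS]mulr1 ler_pM// ?spline_step2_norm// -e1 hh.
  - apply: (zero i m (fun L u m => spline_step R L u m.+1 - spline_step R L u m)) => //.
    exact: spline_step2_outside.
pose D m := v + (2 * m%:R + 1) * v ^+ 2 / 2 + \sum_(i <- iota 0 K) h i * spline_step R L (u i) m.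
have DE m : parabola R N m.+1 + \sum_(i <- iota 0 K) h i * spline R L (u i) m.+1
    - (parabola R N m + \sum_(i <- iota 0 K) h i * spline R L (u i) m) = D m.
  rewrite opprD addrACA parabola_step// -sumrB /D; congr (_ + _).
    by rewrite /v; field; rewrite lt0r_neq0.
  by apply: eq_bigr => i _; rewrite -mulrBr spline_stepE.
split=> -[//|m] _ mN; rewrite /= ?DE.
  have := S1 m; rewrite ler_norml /D => /andP[lo hi].
  have Lv : v ^+ 2 / 2 * L%:R <= v / 2.
    have -> : v ^+ 2 / 2 * L%:R = v / 2 * (L%:R * v) by ring.
    by rewrite -[leRHS]mulr1 ler_pM2l ?divr_gt0// -[leRHS]Nv ler_pM2r// ler_nat.
  have mv : m%:R * v ^+ 2 <= v.
    rewrite expr2 mulrA -[leRHS]mul1r ler_pM2r// -[leRHS]Nv ler_pM2r// ler_nat; lia.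
  have v1 : v ^+ 2 <= v.
    by rewrite expr2 -[leRHS]mul1r ler_pM2r// invf_le1// ler1n.
  have m0 : 0 <= m%:R * v ^+ 2 by rewrite mulr_ge0// exprn_ge0// ltW.
  have v2 : 0 <= v ^+ 2 by rewrite exprn_ge0// ltW.
  have -> : 1 / (4 * N%:R) = v / 4 by rewrite /v; field; rewrite lt0r_neq0.
  have -> : 4 / N%:R = 4 * v by [].
  by apply/andP; split; lra.
have DD : D m.+1 - D m = v ^+ 2 + \sum_(i <- iota 0 K) h i *
    (spline_step R L (u i) m.+1 - spline_step R L (u i) m).
  rewrite /D opprD addrACA -sumrB; congr (_ + _).
    by rewrite -natr1; field.
  by apply: eq_bigr => i _; rewrite -mulrBr.
have := S2 m; rewrite DD ler_norml => /andP[lo hi].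
have v2 : 0 <= v ^+ 2 by rewrite exprn_ge0// ltW.
have -> : 1 / (4 * N%:R ^+ 2) = v ^+ 2 / 4 by rewrite /v; field; rewrite lt0r_neq0.
have -> : 4 / N%:R ^+ 2 = 4 * v ^+ 2 by rewrite /v exprVn.
by apply/andP; split; lra.
Qed.

(* Splines supported in disjoint blocks of length M carry one term of each block of G to the
   nearest point of the lattice (1/X)Z. *)
Lemma lattice_points_of_blocks (R : realType) (N K L M : nat) (X : R) (G : pred nat) :
  (0 < N)%N -> (0 < L <= N)%N -> (M * K <= N)%N -> (0 < M)%N -> 0 < X ->
  (forall i, (i < K)%N -> G i -> exists u : nat,
     [/\ (M * i <= u)%N, (u + 4 * L <= M * i.+1)%N &
      exists k : int, `|X * parabola R N (u + 2 * L) - k%:~R| <= X * L%:R ^+ 2 / (2 * N%:R ^+ 2)]) ->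
  exists a : nat -> R, uniformly_convex N a /\
    (count G (iota 0 K) <= count (fun n => `[< exists k : int, (X * a n)%R = k%:~R >]) (iota 1 N))%N.
Proof.
move=> N0 /andP[L0 LN] MK M0 X0 hG.
have NR : 0 < N%:R :> R by rewrite ltr0n.
have LR : 0 < L%:R :> R by rewrite ltr0n.
have [u uP] := choice_in 0%N (D := fun i => (i < K)%N && G i) (P := fun i u =>
  [/\ (M * i <= u)%N, (u + 4 * L <= M * i.+1)%N &
      exists k : int, `|X * parabola R N (u + 2 * L) - k%:~R| <= X * L%:R ^+ 2 / (2 * N%:R ^+ 2)])
  (fun i => fun D => let: conj a b := andP D in hG i a b).
have [k kP] := choice_in (0 : int) (D := fun i => (i < K)%N && G i)
  (P := fun i k => `|X * parabola R N (u i + 2 * L) - k%:~R| <= X * L%:R ^+ 2 / (2 * N%:R ^+ 2))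
  (fun i Di => let: And3 _ _ c := uP i Di in c).
(* The spline peaks at L^2, so this coefficient makes [X * a] equal to [k i] at the midpoint; the
   assumed distance bound is exactly what gives |h i| <= 1/(2N^2). *)
pose h i := if G i then ((k i)%:~R - X * parabola R N (u i + 2 * L)) / (X * L%:R ^+ 2) else 0.
have XL : 0 < X * L%:R ^+ 2 by rewrite mulr_gt0// exprn_gt0.
have hG0 i : h i != 0 -> G i by rewrite /h; case: (G i); rewrite ?eqxx.
pose a n := parabola R N n.-1 + \sum_(i <- iota 0 K) h i * spline R L (u i) n.-1.
exists a; split.
  apply: (perturbed_parabola_convex (M := M)) => // i iK.
    by move=> /hG0 Gi; have [] := uP i ltac:(by rewrite iK Gi).
  rewrite /h; case: ifP => Gi; last by rewrite normr0 divr_ge0// mulr_ge0// exprn_ge0.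
  rewrite normrM normfV (gtr0_norm XL) ler_pdivrMr// distrC.
  by rewrite mul1r [leRHS]mulrC kP ?iK.
pose c i := (u i + 2 * L).+1.
have cP i : (i < K)%N && G i -> (1 <= c i <= N)%N /\ exists k : int, X * a (c i) = k%:~R.
  move=> Di; have [h1 h2 _] := uP i Di; have /andP[iK Gi] := Di.
  have MiK : (M * i.+1 <= M * K)%N by rewrite leq_mul2l iK orbT.
  split; first by rewrite /c /=; lia.
  exists (k i); rewrite /a /c /= (sum_iota_single (j := i)) ?iK.
    by rewrite spline_peak /h Gi; field; rewrite !lt0r_neq0.
  move=> j jK ji; rewrite /h; case: ifP => Gj; last by rewrite mul0r.
  have [h3 h4 _] := uP j ltac:(by rewrite jK Gj).
  rewrite spline_outside ?mulr0//; apply/negP => /andP[h5 h6].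
  case: (ltngtP j i) ji => // ji _.
    by have : (M * j.+1 <= M * i)%N; [rewrite leq_mul2l ji orbT|lia].
  by have : (M * i.+1 <= M * j)%N; [rewrite leq_mul2l ji orbT|lia].
rewrite -2!size_filter -(size_map c); apply: uniq_leq_size.
  rewrite map_inj_in_uniq ?filter_uniq ?iota_uniq// => i j.
  rewrite !mem_filter !mem_iota => /andP[Gi /andP[_ iK]] /andP[Gj /andP[_ jK]].
  have [h1 h2 _] := uP i ltac:(by rewrite iK Gi); have [h3 h4 _] := uP j ltac:(by rewrite jK Gj).
  rewrite /c => -[/addIn uij]; case: (ltngtP j i) => // ji.
    by have : (M * j.+1 <= M * i)%N; [rewrite leq_mul2l ji orbT|lia].
  by have : (M * i.+1 <= M * j)%N; [rewrite leq_mul2l ji orbT|lia].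
move=> _ /mapP[i + ->]; rewrite !mem_filter !mem_iota => /andP[Gi /andP[_ iK]].
have [/andP[h1 h2] h3] := cP i ltac:(by rewrite iK Gi).
by rewrite h1 add1n ltnS h2 !andbT; apply/asboolP.
Qed.

(** * Diophantine approximation and counting tools *)

(** Pigeonhole: among the T + 1 multiples [j * theta] with [j <= T], two have fractional parts in
    the same of T boxes of length 1/T. *)
Lemma dirichlet_approximation (R : realType) (theta : R) (T : nat) : (0 < T)%N ->
  exists p : nat, exists q : int,
    [/\ (0 < p <= T)%N, coprimez p q & `|p%:R * theta - q%:~R| < 1 / T%:R].
Proof.
move=> T0; have TR : 0 < T%:R :> R by rewrite ltr0n.
pose fr j : R := j%:R * theta - (Num.floor (j%:R * theta))%:~R.
have fr_itv j : 0 <= fr j < 1.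
  by have /andP[] := floor_itv (j%:R * theta); rewrite /fr intrD; lra.
have box_lt j : (Num.truncn (T%:R * fr j) < T)%N.
  have /andP[f0 f1] := fr_itv j.
  by rewrite truncn_lt_nat ?mulr_ge0// -[ltRHS]mulr1 ltr_pM2l.
pose box (j : 'I_T.+1) : 'I_T := Ordinal (box_lt j).
have [i [j [ij fij]]] : exists i j : nat, (i < j <= T)%N /\ `|fr j - fr i| < 1 / T%:R.
  have /injectivePn[i [j ij E]] : ~~ injectiveb box.
    by apply/injectiveP => /leq_card; rewrite !card_ord ltnn.
  have tE : Num.truncn (T%:R * fr i) = Num.truncn (T%:R * fr j) by case: E.
  have close : `|fr j - fr i| < 1 / T%:R.
    have bd k : (Num.truncn (T%:R * fr k))%:R <= T%:R * fr k
                  < (Num.truncn (T%:R * fr k)).+1%:R.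
      by apply: truncn_itv; have /andP[f0 _] := fr_itv k; rewrite mulr_ge0.
    have := bd i; have := bd j; rewrite tE -natr1 => /andP[a1 a2] /andP[b1 b2].
    rewrite ltr_pdivlMr// mulrC -[X in X * _](gtr0_norm TR) -normrM mulrBr ltr_norml.
    by apply/andP; split; lra.
  case: (ltngtP i j) => h.
  - by exists i, j; rewrite h -ltnS ltn_ord.
  - by exists j, i; rewrite h -ltnS ltn_ord distrC.
  - by rewrite -(inj_eq val_inj) /= h eqxx in ij.
pose p := (j - i)%N; pose q := Num.floor (j%:R * theta) - Num.floor (i%:R * theta).
have p0 : (0 < p)%N by rewrite /p; lia.
have pq : `|p%:R * theta - q%:~R| < 1 / T%:R.
  rewrite /p /q natrB; last lia.
  rewrite intrB (_ : _ - _ = fr j - fr i)// /fr; ring.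
(* Cancelling the gcd gives coprimality, and divides the error by the same factor. *)
have g0 : (0 < gcdn p `|q|)%N by rewrite gcdn_gt0 p0.
set g := gcdn p `|q| in g0.
have [p' pE] : exists p', p = (p' * g)%N by apply/dvdnP; rewrite dvdn_gcdl.
have [q' qE] : exists q' : int, q = q' * g%:Z.
  by apply/dvdzP; rewrite dvdzE dvdn_gcdr.
have gR : 0 < g%:R :> R by rewrite ltr0n.
exists p', q'; split.
- have p'0 : (0 < p')%N by move: p0; rewrite pE muln_gt0 => /andP[].
  by rewrite p'0 /=; apply: (@leq_trans p); [rewrite pE leq_pmulr | rewrite /p; lia].
- have := erefl g; rewrite {1}/g pE qE abszM absz_nat -muln_gcdl => /eqP.
  by rewrite -{2}[g]mul1n eqn_pmul2r// /coprimez /gcdz /= => /eqP->.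
- apply: le_lt_trans pq; rewrite pE qE natrM intrM /= mulrAC -mulrBl normrM.
  by rewrite [`|g%:R|]gtr0_norm// ler_peMr// ler1n.
Qed.

(** As [q] is invertible modulo [p], the terms run modulo 1 through all of y + (1/p)Z, and one of
    these classes falls in [0, 1/p). *)
Lemma progression_near_integer (R : realType) (p : nat) (q : int) (y : R) :
  (0 < p)%N -> coprimez p q ->
  exists j : nat, exists k : int,
    (j < p)%N /\ 0 <= y + j%:R * (q%:~R / p%:R) - k%:~R < 1 / p%:R.
Proof.
move=> p0 pq; have pR : 0 < p%:R :> R by rewrite ltr0n.
have [[u v] uv] : exists uv : int * int, uv.1 * p%:Z + uv.2 * q = 1.
  have [u [v E]] := Bezoutz p%:Z q; exists (u, v) => /=.
  by rewrite E; move: pq; rewrite /coprimez => /eqP.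
rewrite /= in uv.
(* By [uv], [v] inverts [q] modulo [p]; this [j] makes [p] divide [f + j * q]. *)
pose f := Num.floor (p%:R * y); pose j := ((- (f * v)) %% p%:Z)%Z.
have j0 : 0 <= j by apply: modz_ge0; lia.
have jp : j < p%:Z by apply: ltz_pmod; lia.
have [k kE] : exists k : int, f + j * q = k * p%:Z.
  exists (f * u - ((- (f * v)) %/ p%:Z)%Z * q).
  have := divz_eq (- (f * v)) p%:Z; rewrite -/j => E.
  have -> : j = - (f * v) - ((- (f * v)) %/ p%:Z)%Z * p%:Z by rewrite {1}E; ring.
  have -> : f = f * (u * p%:Z + v * q) by rewrite uv mulr1.
  set d := (_ %/ _)%Z; rewrite uv mulr1; transitivity (f * (u * p%:Z + v * q) - f * v * q - d * p%:Z * q).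
    by rewrite uv; ring.
  by ring.
exists `|j|%N, k; split; first by lia.
rewrite natr_absz ger0_norm//.
have E : p%:R * (y + j%:~R * (q%:~R / p%:R) - k%:~R) = p%:R * y - f%:~R.
  have /(congr1 (fun x : int => x%:~R : R)) := kE.
  rewrite intrD !intrM /= => kE'.
  have -> : p%:R * (y + j%:~R * (q%:~R / p%:R) - k%:~R)
     = p%:R * y + j%:~R * q%:~R - k%:~R * p%:R by field; rewrite lt0r_neq0.
  by rewrite -kE'; ring.
have /andP[] := floor_itv (p%:R * y); rewrite -/f intrD => h1 h2.
rewrite -(pmulr_rge0 _ pR) ltr_pdivlMr// [X in X < _]mulrC E.
by apply/andP; split; lra.
Qed.

(** The admissible [i] lie in an interval of length [2 * e / A]. *)
Lemma count_linear_window (R : realType) (K : nat) (A B e : R) (G : pred nat) :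
  0 < A -> 0 <= e ->
  (forall i, G i -> `|A * i%:R - B| <= e) ->
  (count G (iota 0 K))%:R <= 2 * e / A + 1.
Proof.
move=> A0 e0 hG; have eA : 0 <= 2 * e / A by rewrite divr_ge0 ?mulr_ge0// ltW.
rewrite -size_filter; set s := [seq i <- _ | G i].
case sE : s => [|m s']; first by rewrite /=; lra.
have s_sorted : sorted ltn s by rewrite sorted_filter ?iota_ltn_sorted//; exact: ltn_trans.
have Gs i : i \in s -> G i by rewrite mem_filter => /andP[].
have min_m i : i \in s -> (m <= i)%N.
  move: s_sorted; rewrite sE /= => /(order_path_min ltn_trans)/allP h.
  by rewrite inE => /orP[/eqP->//|/h /ltnW].
have Gm : G m by apply: Gs; rewrite sE mem_head.
rewrite -sE.
have : (size s <= size (iota m (Num.truncn (2 * e / A)).+1))%N.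
  apply: uniq_leq_size; first by rewrite filter_uniq ?iota_uniq.
  move=> i si; have mi := min_m i si.
  rewrite mem_iota mi addnS ltnS -leq_subLR truncn_ge_nat// natrB//.
  rewrite ler_pdivlMr// mulrC mulrBr.
  have := hG _ (Gs i si); have := hG _ Gm; rewrite !ler_norml => /andP[? ?] /andP[? ?]; lra.
rewrite size_iota -(ler_nat R) => /le_trans; apply.
by rewrite -natr1 lerD2r truncn_le.
Qed.

Lemma count_cover (I J : eqType) (s : seq I) (r : seq J) (G : pred I) (Q : J -> pred I) :
  (forall i, i \in s -> G i -> exists2 j, j \in r & Q j i) ->
  (count G s <= \sum_(j <- r) count (Q j) s)%N.
Proof.
elim: s => [|i s IH] h; first by rewrite big1.
rewrite /= big_split /= leq_add//; last by apply: IH => k ks; apply: h; rewrite inE ks orbT.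
case: (boolP (G i)) => // Gi; have [j jr Qji] := h i (mem_head _ _) Gi.
by rewrite (big_rem j)//= Qji.
Qed.

Lemma sum_count_le (R : realType) (I J : eqType) (s : seq I) (r : seq J) (Q : J -> pred I) (c : R) :
  (forall j, j \in r -> (count (Q j) s)%:R <= c) ->
  (\sum_(j <- r) count (Q j) s)%N%:R <= (size r)%:R * c.
Proof.
elim: r => [|j r IH] h; first by rewrite big_nil mul0r.
rewrite big_cons natrD /= -natr1 mulrDl mul1r addrC lerD// ?IH ?h ?mem_head//.
by move=> k kr; apply: h; rewrite inE kr orbT.
Qed.

(** * Coarse lattices: N^alpha at most a constant times sqrt N *)

Lemma parabola_step_bounds (R : realType) (N m : nat) : (m < N)%N ->
  1 / N%:R <= parabola R N m.+1 - parabola R N m <= 2 / N%:R.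
Proof.
move=> mN; have N0 : (0 < N)%N by lia.
have NR : 0 < N%:R :> R by rewrite ltr0n.
rewrite parabola_step// lerDl divr_ge0 ?mulr_ge0 ?exprn_ge0 ?addr_ge0 ?mulr_ge0//=.
have -> : 2 / N%:R = 1 / N%:R + 2 * N%:R / (2 * N%:R ^+ 2) :> R by field; rewrite lt0r_neq0.
rewrite lerD2l ler_pM2r ?invr_gt0 ?mulr_gt0 ?exprn_gt0//.
have : (2 * m + 1 <= 2 * N)%N by lia.
by rewrite -(ler_nat R) natrD !natrM.
Qed.

Lemma parabola_convex (R : realType) (N : nat) : (0 < N)%N ->
  uniformly_convex N (fun n => parabola R N n.-1).
Proof.
move=> N0; have := @perturbed_parabola_convex R N 0 0 1 (fun=> 0) (fun=> 0%N) N0 (leq0n _).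
move=> /(_ isT (fun i iK => False_ind _ (notF iK)) (fun i iK => False_ind _ (notF iK))).
rewrite (_ : (fun n => _ + _) = (fun n => parabola R N n.-1))//.
by apply/funext => n; rewrite big_nil addr0.
Qed.

(** Discrete intermediate values: the first term to reach the ceiling of [f 0] overshoots it by at
    most one step. *)
Lemma crossing_integer (R : realType) (f : nat -> R) (D : nat) (e : R) :
  0 <= e -> f 0%N + 1 <= f D -> (forall m, (m < D)%N -> f m.+1 - f m <= e) ->
  exists m : nat, exists k : int, (m <= D)%N /\ `|f m - k%:~R| <= e.
Proof.
move=> e0 fD fe; pose k := Num.ceil (f 0%N).
have /andP[k1 k2] := ceil_itv (f 0%N); rewrite -/k intrB in k1 k2.
have ex : exists m, k%:~R <= f m by exists D; lra.
case: (ex_minnP ex) => m km min_m.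
have mD : (m <= D)%N by apply: min_m; lra.
exists m, k; split=> //; case: m km min_m mD => [|m] km min_m mD.
  by rewrite (_ : f 0%N = k%:~R) ?subrr ?normr0//; apply/eqP; rewrite eq_le k2 km.
have fm : f m < k%:~R by rewrite ltNge; apply/negP => /min_m; rewrite ltnn.
by rewrite ger0_norm ?subr_ge0//; have := fe m mD; lra.
Qed.

(** Over D, about N/X, indices the scaled parabola grows by at least 1 in steps of at most 2X/N, so
    it comes within 2X/N of an integer. Taking L above 2 sqrt N lets a spline bridge this gap, and
    sqrt N <= S N/X keeps the block length of order S N/X. *)
Lemma coarse_lattice_points (R : realType) (N : nat) (X S : R) :
  (0 < N)%N -> 1 <= X -> 1 <= S -> X <= S * Num.sqrt N%:R ->
  exists a : nat -> R, uniformly_convex N a /\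
    X / (36 * S) <= (count (fun n => `[< exists k : int, X * a n = k%:~R >]) (iota 1 N))%:R.
Proof.
move=> N0 X1 S1 XS; have X0 : 0 < X by lra.
have S0 : 0 < S by lra.
have NR : 1 <= N%:R :> R by rewrite ler1n.
have N0R : 0 < N%:R :> R by lra.
(* In this case one lattice point is enough, and the parabola starts at 0. *)
case: (ltrP X (36 * S)) => XbigS.
  exists (fun n => parabola R N n.-1); split; first exact: parabola_convex.
  apply: (@le_trans _ _ 1); first by rewrite ler_pdivrMr ?mulr_gt0// mul1r ltW.
  rewrite ler1n -has_count; apply/hasP; exists 1%N; first by rewrite mem_iota /=; lia.
  apply/asboolP; exists 0; rewrite /parabola /=; ring.
set w := Num.sqrt N%:R in XS.
have w1 : 1 <= w by rewrite -sqrtr1 ler_sqrt.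
have w2 : w ^+ 2 = N%:R by rewrite sqr_sqrtr.
pose r := N%:R / X.
have r0 : 0 < r by rewrite divr_gt0.
have wr : w <= S * r.
  by rewrite /r mulrA ler_pdivlMr// -w2 expr2 mulrA mulrC ler_pM2r//; lra.
pose D := (Num.truncn r).+1; pose L := (Num.truncn (2 * w)).+1.
have rD : r < D%:R <= r + 1.
  by rewrite truncnS_gt /D -natr1 lerD2r truncn_le ltW.
have wL : 2 * w < L%:R <= 2 * w + 1.
  by rewrite truncnS_gt /L -natr1 lerD2r truncn_le mulr_ge0//; lra.
have D0 : (0 < D)%N by [].
have L0 : (0 < L)%N by [].
clearbody D L; move: rD wL => /andP[D1 D2] /andP[L1 L2].
have [M ME] : exists M, M = (4 * L + D)%N by exists (4 * L + D)%N.
have MR : M%:R = 4 * L%:R + D%:R :> R by rewrite ME natrD natrM.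
have Sr : r <= S * r by rewrite ler_peMl// ltW.
(* 4L + D is at most 8w + r + 5, and each of w, r and 1 is at most S r. *)
have M14 : M%:R <= 14 * (S * r) by lra.
have MX : M%:R * X <= 14 * S * N%:R.
  apply: le_trans (_ : 14 * (S * r) * X <= _); first by rewrite ler_pM2r.
  by rewrite (_ : 14 * (S * r) * X = 14 * S * N%:R)// /r; field; rewrite lt0r_neq0.
have MN : M%:R <= N%:R :> R.
  have h : M%:R * (36 * S) <= M%:R * X by rewrite ler_wpM2l.
  have h2 : M%:R * 36 <= 14 * N%:R :> R.
    by rewrite -(ler_pM2r S0) -mulrA (le_trans h)// (le_trans MX)// -!mulrA [S * _]mulrC.
  lra.
have M0 : (0 < M)%N by rewrite ME addn_gt0 D0 orbT.
have M0R : 0 < M%:R :> R by rewrite ltr0n.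
pose K := (N %/ M)%N.
have KN : (M * K <= N)%N by rewrite mulnC leq_trunc_div.
have NK : N%:R < M%:R * (K%:R + 1) :> R.
  by rewrite natr1 -natrM ltr_nat mulnC ltn_ceil.
have [||a [ac aK]] := @lattice_points_of_blocks R N K L M X predT N0 _ KN M0 X0.
- by rewrite ler_nat in MN; clear - MN ME L0; lia.
- move=> i iK _; have MiK : (M * i.+1 <= M * K)%N by rewrite leq_mul2l iK orbT.
  rewrite mulnS in MiK.
  have inN m : (m <= D)%N -> (M * i + 2 * L + m <= N)%N by clear - MiK ME KN; lia.
  pose f m := X * parabola R N (M * i + 2 * L + m).
  have step m : (m < D)%N -> X / N%:R <= f m.+1 - f m <= 2 * (X / N%:R).
    move=> mD; rewrite /f -mulrBr addnS.
    have /andP[lo hi] := @parabola_step_bounds R N (M * i + 2 * L + m) ltac:(by rewrite -addnS inN).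
    by apply/andP; split; [rewrite ler_pM2l// -[leLHS]mul1r|rewrite mulrCA ler_pM2l].
  have fD m : (m <= D)%N -> f 0%N + m%:R * (X / N%:R) <= f m.
    elim: m => [|m IH] mD; first by rewrite mul0r addr0.
    have /andP[lo _] := step m mD; have := IH (ltnW mD).
    rewrite -natr1 mulrDl mul1r; lra.
  have XN0 : 0 < X / N%:R by rewrite divr_gt0.
  have [|||m [k [mD fk]]] := @crossing_integer R f D (2 * (X / N%:R)).
  + by rewrite mulr_ge0// ltW.
  + apply: le_trans (fD D (leqnn _)); rewrite lerD2l.
    have E : 1 = r * (X / N%:R) by rewrite /r; field; rewrite !lt0r_neq0.
    by rewrite [leLHS]E ler_pM2r// ltW.
  + by move=> m /step/andP[].
  exists (M * i + m)%N; split.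
  + by rewrite leq_addr.
  + by rewrite mulnS; clear - mD ME; lia.
  exists k; rewrite addnAC; apply: le_trans fk _.
  have -> : 2 * (X / N%:R) = X * (4 * w ^+ 2) / (2 * N%:R ^+ 2).
    by rewrite w2; field; rewrite lt0r_neq0.
  rewrite ler_pM2r ?invr_gt0 ?mulr_gt0 ?exprn_gt0// ler_pM2l//.
  have -> : 4 * w ^+ 2 = (2 * w) ^+ 2 by ring.
  by rewrite lerXn2r ?nnegrE ?ltW//; lra.
exists a; split=> //.
apply: (@le_trans _ _ K%:R); last by rewrite ler_nat; move: aK; rewrite count_predT size_iota.
have h1 : X < 14 * S * (K%:R + 1).
  rewrite -(ltr_pM2l M0R); apply: le_lt_trans MX _.
  by rewrite mulrCA ltr_pM2l ?mulr_gt0.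
rewrite ler_pdivrMr ?mulr_gt0//.
(* The incomplete last block costs 36 S, which is at most X here, while 36/14 exceeds 2. *)
have -> : K%:R * (36 * S) = 36 / 14 * (14 * S * (K%:R + 1)) - 36 * S by field.
lra.
Qed.

(** * Fine lattices: slopes and rational approximation *)

(** Exact Taylor expansion at [s]; the coefficient of [j] is the tangent slope in lattice units, to
    which Dirichlet approximation is applied. *)
Lemma parabola_expand (R : realType) (N s j : nat) (X : R) : (0 < N)%N ->
  X * parabola R N (s + j) = X * parabola R N s
    + j%:R * (X / N%:R + X / N%:R ^+ 2 * s%:R) + X / N%:R ^+ 2 * j%:R ^+ 2 / 2.
Proof.
move=> N0; rewrite /parabola natrD; field.
by rewrite pnatr_eq0 -lt0n.
Qed.

(* The values at s, ..., s + p - 1 are, up to errors of order rho, an arithmetic progression of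
   step q/p, so one of them is within 1/p of an integer; p > T/64 makes 1/p comparable to rho. *)
Lemma near_integer_of_slope (R : realType) (N s T : nat) (X rho : R) :
  (0 < N)%N -> (0 < T)%N -> 0 < rho -> X / N%:R ^+ 2 = rho ^+ 3 -> 1 < 2 * (T%:R * rho) ->
  (forall p : nat, forall q : int, (0 < p)%N -> (64 * p <= T)%N ->
     1 / T%:R <= `|p%:R * (X / N%:R + X / N%:R ^+ 2 * s%:R) - q%:~R|) ->
  exists j : nat, (j <= T)%N /\ exists k : int,
    `|X * parabola R N (s + j) - k%:~R| <= X * (33 * T)%N%:R ^+ 2 / (2 * N%:R ^+ 2).
Proof.
move=> N0 T0 rho0 Xrho Trho good.
set theta := _ + _ in good.
have TR : 0 < T%:R :> R by rewrite ltr0n.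
have [p [q [/andP[p0 pT] pq close]]] := dirichlet_approximation theta T0.
have pR : 0 < p%:R :> R by rewrite ltr0n.
have p64 : (T < 64 * p)%N.
  rewrite ltnNge; apply/negP => /(good p q p0).
  by rewrite leNgt close.
have [j [k [jp /andP[k1 k2]]]] := progression_near_integer (X * parabola R N s) p0 pq.
have jT : (j <= T)%N by lia.
exists j; split=> //; exists k.
rewrite parabola_expand// -/theta Xrho.
have -> : X * (33 * T)%N%:R ^+ 2 / (2 * N%:R ^+ 2) = 1089 / 2 * (rho ^+ 3 * T%:R ^+ 2).
  by rewrite -Xrho natrM; field; rewrite pnatr_eq0 -lt0n.
have slope_err : `|j%:R * theta - j%:R * (q%:~R / p%:R)| <= 1 / T%:R.
  rewrite -mulrBr.
  have -> : theta - q%:~R / p%:R = (p%:R * theta - q%:~R) / p%:R by field; rewrite lt0r_neq0.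
  rewrite !normrM normfV !normr_nat mulrCA -[leRHS]mulr1.
  apply: ler_pM => //; rewrite ?mulr_ge0 ?invr_ge0//; first exact: ltW.
  by rewrite ler_pdivrMr// mul1r ler_nat ltnW.
have quad : rho ^+ 3 * j%:R ^+ 2 / 2 <= rho ^+ 3 * T%:R ^+ 2 / 2.
  rewrite ler_pM2r ?invr_gt0// ler_pM2l ?exprn_gt0//.
  by rewrite lerXn2r ?nnegrE// ler_nat.
have quad0 : 0 <= rho ^+ 3 * j%:R ^+ 2 / 2.
  by rewrite divr_ge0// mulr_ge0 ?exprn_ge0// ltW.
have T2 : 1 / T%:R <= 2 * rho.
  by rewrite ler_pdivrMr// -mulrA [rho * _]mulrC ltW.
have p2 : 1 / p%:R <= 128 * rho.
  rewrite ler_pdivrMr//.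
  have : T%:R <= 64 * p%:R :> R by rewrite -natrM ler_nat ltnW.
  move=> /(ler_wpM2r (ltW rho0)); lra.
have cube : rho / 4 <= rho ^+ 3 * T%:R ^+ 2.
  have -> : rho ^+ 3 * T%:R ^+ 2 = rho * (T%:R * rho) ^+ 2 by ring.
  rewrite ler_pM2l//; have := mulr_gt0 (lt_trans ltr01 Trho) (lt_trans ltr01 Trho).
  have : 1 <= (2 * (T%:R * rho)) ^+ 2 by rewrite expr_ge1// ltW// (lt_trans ltr01).
  rewrite exprMn; lra.
(* The errors are 128 rho from 1/p, 2 rho from the slope and half of rho^3 T^2 from curvature. The
   allowance 33^2/2 times rho^3 T^2 covers them, because rho^3 T^2 >= rho/4. *)
move: slope_err; rewrite !ler_norml => /andP[s1 s2].
by apply/andP; split; lra.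
Qed.

(* For each p <= T/64 at most 4 p sigma numerators q are relevant, and each of them spoils at most
   2/(T p delta) + 1 of the slopes, which are equally spaced by delta. *)
Lemma count_bad_slopes (R : realType) (K T : nat) (sigma delta rho : R) (theta : nat -> R) :
  (0 < T)%N -> 0 < delta -> 0 < rho -> T%:R * rho <= 1 ->
  33 * rho <= delta * T%:R -> 3 * rho <= sigma -> 1 / T%:R <= 2 * rho ->
  (forall i, theta i = theta 0%N + delta * i%:R) ->
  (forall i, (i < K)%N -> sigma <= theta i <= 2 * sigma) ->
  (count (fun i => `[< exists p : nat, exists q : int, [/\ (0 < p)%N, (64 * p <= T)%N &
     `|p%:R * theta i - q%:~R| < 1 / T%:R] >]) (iota 0 K))%:R <= sigma / rho ^+ 2 / 200.
Proof.
move=> T0 delta0 rho0 Trho dT rs T2 thetaE theta_bd.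
have TR : 0 < T%:R :> R by rewrite ltr0n.
have s0 : 0 < sigma by lra.
pose r := iota 1 (T %/ 64).
pose Q (p i : nat) := has (fun q : nat => `|p%:R * theta i - q%:R| < 1 / T%:R)
  (iota 1 (Num.truncn (4 * p%:R * sigma))).
(* Bound for a single denominator: the first term counts numerators, using p <= T/64 <= 1/(64 rho);
   the second adds up the window lengths, using delta T >= 33 rho. *)
pose c : R := 4 * sigma * (1 / (64 * rho)) + 8 * sigma / (33 * rho).
have r_in p : p \in r -> (0 < p)%N /\ (64 * p <= T)%N.
  rewrite mem_iota => /andP[p0 pT]; split=> //.
  have : (p <= T %/ 64)%N by lia.
  by rewrite leq_divRL// mulnC.
set bad := (X in count X _).
have cover : (count bad (iota 0 K) <= \sum_(p <- r) count (Q p) (iota 0 K))%N.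
  apply: count_cover => i; rewrite mem_iota add0n => /andP[_ iK] /asboolP[p [q [p0 p64 close]]].
  have /andP[t1 t2] := theta_bd i iK.
  have p1 : 1 <= p%:R :> R by rewrite ler1n.
  exists p; first by rewrite mem_iota p0 add1n ltnS leq_divRL// mulnC.
  have pt1 : p%:R * sigma <= p%:R * theta i by rewrite ler_wpM2l.
  have pt2 : p%:R * theta i <= p%:R * (2 * sigma) by rewrite ler_wpM2l.
  have ps : sigma <= p%:R * sigma by rewrite ler_peMl// ltW.
  move: (close); rewrite ltr_norml => /andP[c1 c2].
  (* [p * theta i] is at least sigma >= 3 rho, whereas 1/T <= 2 rho; hence natural numerators
     suffice. *)
  have q0 : 0 < q by rewrite -(ltr_int R); lra.
  apply/hasP; exists `|q|%N.
    rewrite mem_iota absz_gt0 gt_eqF//= add1n ltnS truncn_ge_nat; last by rewrite !mulr_ge0// ltW.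
    by rewrite natr_absz gtr0_norm//; lra.
  by rewrite natr_absz (gtr0_norm q0).
have each p : p \in r -> (count (Q p) (iota 0 K))%:R <= c.
  move=> /r_in[p0 p64].
  have p1 : 1 <= p%:R :> R by rewrite ler1n.
  have pR : 0 < p%:R :> R by lra.
  pose near (q i : nat) := `|p%:R * theta i - q%:R| < 1 / T%:R.
  set n := Num.truncn (4 * p%:R * sigma).
  have h1 : (count (Q p) (iota 0 K) <= \sum_(q <- iota 1 n) count (near q) (iota 0 K))%N.
    by apply: count_cover => i _ /hasP[q qr h]; exists q.
  have h2 : (\sum_(q <- iota 1 n) count (near q) (iota 0 K))%N%:R
      <= (size (iota 1 n))%:R * (2 * (1 / T%:R) / (p%:R * delta) + 1).
    apply: sum_count_le => q _.
    apply: (@count_linear_window R K (p%:R * delta) (q%:R - p%:R * theta 0%N) (1 / T%:R)); first by rewrite mulr_gt0.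
      by rewrite divr_ge0// ltW.
    move=> i /ltW; rewrite thetaE; congr (`|_| <= _); ring.
  rewrite -(ler_nat R) in h1; apply: le_trans h1 _; apply: le_trans h2 _.
  rewrite size_iota.
  apply: (@le_trans _ _ (4 * p%:R * sigma * (2 * (1 / T%:R) / (p%:R * delta) + 1))).
    rewrite ler_wpM2r//; last by rewrite truncn_le !mulr_ge0// ltW.
    by rewrite addr_ge0// divr_ge0 ?mulr_ge0 ?invr_ge0 ?ler0n// ltW.
  have -> : 4 * p%:R * sigma * (2 * (1 / T%:R) / (p%:R * delta) + 1)
      = 4 * sigma * p%:R + 8 * sigma / (delta * T%:R).
    by field; rewrite !lt0r_neq0.
  rewrite /c lerD//.
    rewrite ler_pM2l ?mulr_gt0// ler_pdivlMr ?mulr_gt0//.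
    have : 64 * p%:R <= T%:R :> R by rewrite -natrM ler_nat.
    move=> /(ler_wpM2r (ltW rho0)); lra.
  by rewrite ler_pM2l ?mulr_gt0// lef_pV2 ?posrE ?mulr_gt0.
rewrite -(ler_nat R) in cover; apply: le_trans cover _.
apply: le_trans (sum_count_le each) _.
have cE : c = (4 / 64 + 8 / 33) * (sigma / rho) by rewrite /c; field; rewrite lt0r_neq0.
have c0 : 0 <= c by rewrite cE mulr_ge0 ?divr_ge0 ?(ltW s0) ?(ltW rho0)//; lra.
have size_le : (size r)%:R <= 1 / (64 * rho).
  rewrite size_iota ler_pdivlMr ?mulr_gt0//.
  have : (64 * (T %/ 64) <= T)%N by rewrite mulnC leq_trunc_div.
  rewrite -(ler_nat R) natrM => /(ler_wpM2r (ltW rho0)); lra.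
apply: le_trans (ler_wpM2r c0 size_le) _.
have -> : 1 / (64 * rho) * c = (4 / 64 + 8 / 33) / 64 * (sigma / rho ^+ 2).
  by rewrite cE; field; rewrite lt0r_neq0.
(* Numerically, (4/64 + 8/33)/64 is about 0.0048, just below 1/200. *)
rewrite mulrC ler_pM2l ?divr_gt0 ?exprn_gt0//; lra.
Qed.

(** With T about 1/rho there are at least N rho/133 - 1 blocks, of which at most N rho/200 are bad.
    As N rho >= 2500, at least N rho/1000 good ones remain. *)
Lemma fine_lattice_points (R : realType) (N : nat) (X rho : R) :
  (0 < N)%N -> 0 < rho <= 1 -> X / N%:R ^+ 2 = rho ^+ 3 -> 2500 <= N%:R * rho ^+ 2 ->
  exists a : nat -> R, uniformly_convex N a /\
    N%:R * rho / 1000 <= (count (fun n => `[< exists k : int, X * a n = k%:~R >]) (iota 1 N))%:R.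
Proof.
move=> N0 /andP[rho0 rho1] Xrho Nrho.
have NR : 0 < N%:R :> R by rewrite ltr0n.
have XE : X = rho ^+ 3 * N%:R ^+ 2 by rewrite -Xrho; field; rewrite lt0r_neq0.
have X0 : 0 < X by rewrite XE mulr_gt0// exprn_gt0.
pose sigma := X / N%:R.
have sE : sigma = rho * (N%:R * rho ^+ 2) by rewrite /sigma XE; field; rewrite lt0r_neq0.
have sr : 2500 * rho <= sigma by rewrite sE mulrC ler_pM2l.
have Nr : 2500 <= N%:R * rho.
  by apply: le_trans Nrho _; rewrite ler_pM2l// expr2 ler_piMr// ltW.
pose T := Num.truncn (1 / rho).
have T0 : (0 < T)%N by rewrite truncn_gt0 ler_pdivlMr// mul1r.
have TR : 1 <= T%:R :> R by rewrite ler1n.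
have Trho : T%:R * rho <= 1 by rewrite -ler_pdivlMr// truncn_le divr_ge0// ltW.
have Trho2 : 1 < 2 * (T%:R * rho).
  have : 1 < (T%:R + 1) * rho by rewrite -ltr_pdivrMr// natr1 truncnS_gt.
  have : rho <= T%:R * rho by rewrite ler_peMl// ltW.
  lra.
(* 133 = 4 * 33 + 1: a block holds a spline of run length L = 33 T together with a shift of at most
   T. *)
clearbody T; pose M := (133 * T)%N; pose L := (33 * T)%N; pose K := (N %/ M)%N.
have M0 : (0 < M)%N by rewrite muln_gt0.
have KN : (M * K <= N)%N by rewrite mulnC leq_trunc_div.
have NK : N%:R < M%:R * (K%:R + 1) :> R.
  by rewrite natr1 -natrM ltr_nat mulnC ltn_ceil.
have LN : (L <= N)%N.
  rewrite -(ler_nat R) /L natrM -(ler_pM2r rho0); lra.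
(* Tangent slope at the leftmost position of a spline midpoint in block [i]. *)
pose theta i := X / N%:R + X / N%:R ^+ 2 * (M * i + 2 * L)%:R.
pose bad i := `[< exists p : nat, exists q : int, [/\ (0 < p)%N, (64 * p <= T)%N &
     `|p%:R * theta i - q%:~R| < 1 / T%:R] >].
have MiK i : (i < K)%N -> (M * i + M <= N)%N.
  by move=> iK; rewrite -mulnSr (leq_trans _ KN)// leq_mul2l iK orbT.
have badK : (count bad (iota 0 K))%:R <= N%:R * rho / 200.
  have -> : N%:R * rho = sigma / rho ^+ 2 by rewrite sE; field; rewrite lt0r_neq0.
  apply: (count_bad_slopes (delta := rho ^+ 3 * M%:R)) => //.
  - by rewrite mulr_gt0 ?exprn_gt0// ltr0n.
  - have h : 1 <= (2 * (T%:R * rho)) ^+ 2 by rewrite expr_ge1 ?ltW// (lt_trans ltr01).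
    have -> : rho ^+ 3 * M%:R * T%:R = rho * (133 / 4 * (2 * (T%:R * rho)) ^+ 2).
      by rewrite /M natrM; field.
    by rewrite mulrC ler_pM2l//; lra.
  - lra.
  - by rewrite ler_pdivrMr//; lra.
  - by move=> i; rewrite /theta Xrho muln0 add0n natrD natrM; ring.
  - move=> i iK; rewrite /theta -/sigma Xrho lerDl mulr_ge0 ?exprn_ge0 ?(ltW rho0)//=.
    have -> : 2 * sigma = sigma + rho ^+ 3 * N%:R.
      by rewrite mulr_natl mulr2n; congr (_ + _); rewrite sE; ring.
       rewrite lerD2l ler_pM2l ?exprn_gt0// ler_nat.
    by apply: leq_trans (MiK i iK); rewrite leq_add2l /M /L mulnA leq_mul2r; apply/orP; right.
have [||a [ac aK]] := @lattice_points_of_blocks R N K L M X (predC bad) N0 _ KN M0 X0.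
- by rewrite LN andbT muln_gt0.
- move=> i iK /asboolPn good.
  have [|j [jT [k kP]]] := @near_integer_of_slope R N (M * i + 2 * L) T X rho N0 T0 rho0 Xrho Trho2.
    by move=> p q p0 p64; rewrite leNgt; apply/negP => close; apply: good; exists p, q.
  exists (M * i + j)%N; split.
  + by rewrite leq_addr.
  + by rewrite -addnA mulnS [leqRHS]addnC leq_add2l /M /L; clear - jT; lia.
  + by exists k; rewrite addnAC.
exists a; split=> //.
apply: (@le_trans _ _ (count (predC bad) (iota 0 K))%:R); last by rewrite ler_nat.
have : (count bad (iota 0 K) + count (predC bad) (iota 0 K) = K)%N.
  by rewrite count_predC size_iota.
move=> /(congr1 (GRing.natmul (1 : R))); rewrite natrD => cE.
have Kbig : N%:R * rho < 133 * (K%:R + 1).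
  have K1 : 0 < K%:R + 1 :> R by rewrite natr1 ltr0n.
  move: NK; rewrite -(ltr_pM2r rho0) => /lt_le_trans; apply.
  rewrite /M natrM.
  have -> : 133 * T%:R * (K%:R + 1) * rho = 133 * (K%:R + 1) * (T%:R * rho) by ring.
  by rewrite ler_piMr// mulr_ge0// ltW.
lra.
Qed.

(** * Powers of N and the conclusion *)

Lemma lattice_count_scaled (R : realType) (N : nat) (a : nat -> R) (alpha : R) :
  (0 < N)%N -> uniformly_convex N a ->
  lattice_count N a alpha =
  count (fun n => `[< exists k : int, N%:R `^ alpha * a n = k%:~R >]) (iota 1 N).
Proof.
move=> N0 ac; rewrite (lattice_countE _ ac); apply: eq_count => n.
have X0 : N%:R `^ alpha != 0 :> R by rewrite lt0r_neq0// powR_gt0// ltr0n.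
apply/asbool_equiv_eq; rewrite /in_lattice powRN; split=> -[k E]; exists k.
  by rewrite E mulrCA mulfV// mulr1.
by rewrite -E mulrC mulKf.
Qed.

Lemma ge1_powR_ge1 (R : realType) (x r : R) : 1 <= x -> 0 <= r -> 1 <= x `^ r.
Proof. by move=> x1 r0; rewrite -(powRr0 x) ler_powR. Qed.

Lemma powR_mul (R : realType) (x r s : R) : 0 < x -> x `^ r * x `^ s = x `^ (r + s).
Proof. by move=> x0; rewrite powRD//; apply/implyP => _; rewrite lt0r_neq0. Qed.

Lemma powR_natX (R : realType) (x r : R) (n : nat) : (x `^ r) ^+ n = x `^ (r * n%:R).
Proof. by rewrite powRrM powR_mulrn// powR_ge0. Qed.

Lemma powR_quot (R : realType) (x r s : R) : 0 < x -> x `^ r / x `^ s = x `^ (r - s).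
Proof. by move=> x0; rewrite -powRN powR_mul. Qed.

(** Here rho = N^((alpha-2)/3), so that N rho = N^((alpha+1)/3). Since (N rho^2)^3 = N^(2 alpha)/N,
    the threshold 50^3 sqrt N becomes N rho^2 >= 50^2 = 2500. *)
Lemma fine_lattice_count (R : realType) (N : nat) (alpha : R) :
  (0 < N)%N -> alpha <= 2 -> 50 ^+ 3 * Num.sqrt N%:R < N%:R `^ alpha :> R ->
  exists a : nat -> R, uniformly_convex N a /\
    N%:R `^ ((alpha + 1) / 3) / 1000 <= (lattice_count N a alpha)%:R.
Proof.
move=> N0 a2 big.
have x1 : 1 <= N%:R :> R by rewrite ler1n.
have x0 : 0 < N%:R :> R by rewrite ltr0n.
pose rho : R := N%:R `^ ((alpha - 2) / 3).
have rho0 : 0 < rho by rewrite powR_gt0.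
have rho1 : rho <= 1.
  by rewrite -(powRr0 N%:R) ler_powR//; lra.
have XE : N%:R `^ alpha / N%:R ^+ 2 = rho ^+ 3.
  rewrite -(powR_mulrn 2 (ltW x0)) powR_quot// /rho powR_natX; congr (_ `^ _); lra.
have cube : 50 ^+ 2 <= N%:R * rho ^+ 2.
  have h0 : 0 <= N%:R * rho ^+ 2 by rewrite mulr_ge0// exprn_ge0// ltW.
  rewrite leNgt; apply/negP => small.
  have : (N%:R * rho ^+ 2) ^+ 3 < (50 ^+ 2) ^+ 3 by rewrite ltrXn2r// nnegrE exprn_ge0.
  have -> : (N%:R * rho ^+ 2) ^+ 3 = (N%:R `^ alpha) ^+ 2 / N%:R.
    rewrite (_ : (N%:R * rho ^+ 2) ^+ 3 = N%:R ^+ 3 * (rho ^+ 3) ^+ 2); last by ring.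
    by rewrite -XE; field; rewrite lt0r_neq0.
  rewrite ltr_pdivrMr// ltNge => /negP; apply.
  have -> : (50 ^+ 2) ^+ 3 * N%:R = (50 ^+ 3 * Num.sqrt N%:R) ^+ 2 :> R.
    by rewrite [RHS]exprMn sqr_sqrtr// -!exprM mulnC.
  by rewrite lerXn2r ?nnegrE ?mulr_ge0 ?exprn_ge0 ?sqrtr_ge0 ?powR_ge0 ?(ltW big).
have cube' : 2500 <= N%:R * rho ^+ 2 by apply: le_trans cube; lra.
have [|a [ac aK]] := fine_lattice_points N0 _ XE cube'; first by rewrite rho0.
exists a; split=> //; rewrite lattice_count_scaled//.
suff -> : N%:R `^ ((alpha + 1) / 3) = N%:R * rho by [].
rewrite /rho -[X in _ = X * _](powRr1 (ltW x0)) powR_mul//; congr (_ `^ _); lra.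
Qed.

Lemma lattice_count_upper (R : realType) (N : nat) (a : nat -> R) (alpha : R) :
  (0 < N)%N -> uniformly_convex N a -> -1 <= alpha ->
  (lattice_count N a alpha)%:R <= 7 * N%:R `^ ((alpha + 1) / 3).
Proof.
move=> N0 ac a1; rewrite lattice_count_scaled//.
have x1 : 1 <= N%:R :> R by rewrite ler1n.
have x0 : 0 < N%:R :> R by rewrite ltr0n.
set Y := N%:R `^ ((alpha + 1) / 3); pose X : R := N%:R `^ alpha.
pose P : R := N%:R `^ ((2 - alpha) / 3); pose Q : R := N%:R `^ ((2 * alpha - 1) / 3).
have Y1 : 1 <= Y by apply: ge1_powR_ge1 => //; lra.
have PQ : P * Q = Y by rewrite /P /Q powR_mul//; congr (_ `^ _); lra.
have NP : N%:R / P = Y.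
  by rewrite -[X in X / _](powRr1 (ltW x0)) powR_quot//; congr (_ `^ _); lra.
have XQ : X / Q = Y by rewrite /X /Q powR_quot//; congr (_ `^ _); lra.
have [X0 P0 Q0] : [/\ 0 < X, 0 < P & 0 < Q] by rewrite !powR_gt0.
apply: le_trans (@convex_count_le R N a X P Q _ ac X0 P0 Q0 _) _.
  by move=> n /asboolP.
(* The four terms contribute Y, Y, 4Y and 1 <= Y, hence the factor 7. *)
by rewrite PQ NP -mulrA XQ; lra.
Qed.

Unset Implicit Arguments.

Theorem theorem3 (R : realType) :
  (exists c : R, 0 < c /\
    (forall (alpha : R) (N : nat), 1 / 2 <= alpha <= 2 -> (10 <= N)%N ->
       exists a : nat -> R, uniformly_convex N a /\
         c * N%:R `^ ((alpha + 1) / 3) <= (lattice_count N a alpha)%:R) /\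
    (forall (alpha : R) (N : nat), 0 <= alpha <= 1 / 2 -> (10 <= N)%N ->
       exists a : nat -> R, uniformly_convex N a /\
         c * N%:R `^ alpha <= (lattice_count N a alpha)%:R)) /\
  (forall eps : R, 0 < eps -> exists C : R, 0 < C /\
    forall (N : nat) (a : nat -> R) (alpha : R),
      (1 <= N)%N -> uniformly_convex N a -> 0 <= alpha <= 2 ->
      (1 / 2 <= alpha <= 2 ->
         (lattice_count N a alpha)%:R <= C * N%:R `^ eps * N%:R `^ ((alpha + 1) / 3)) /\
      (0 <= alpha <= 1 / 2 ->
         (lattice_count N a alpha)%:R <= 100 * N%:R `^ alpha)).
Proof.
have S1 : 1 <= 50 ^+ 3 :> R by rewrite exprn_ege1//; lra.
have S0 : 0 < 36 * 50 ^+ 3 :> R by lra.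
have coarse (alpha : R) (N : nat) : 0 <= alpha -> (10 <= N)%N ->
    N%:R `^ alpha <= 50 ^+ 3 * Num.sqrt N%:R :> R ->
    exists a : nat -> R, uniformly_convex N a /\
      N%:R `^ alpha / (36 * 50 ^+ 3) <= (lattice_count N a alpha)%:R.
  move=> a0 N10 XS; have N0 : (0 < N)%N by apply: leq_trans N10.
  have [|a [ac aK]] := coarse_lattice_points N0 _ S1 XS.
    by apply: ge1_powR_ge1 => //; rewrite ler1n.
  by exists a; rewrite lattice_count_scaled.
split.
  (* The constant of the coarse case with S = 50^3; it is below the 1/1000 of the fine case. *)
  exists (1 / (36 * 50 ^+ 3)); split; first by rewrite divr_gt0.
  split=> alpha N /andP[a1 a2] N10.
    have N0 : (0 < N)%N by apply: leq_trans N10.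
    have x1 : 1 <= N%:R :> R by rewrite ler1n.
    case: (lerP (N%:R `^ alpha) (50 ^+ 3 * Num.sqrt N%:R : R)) => XS.
      have [|a [ac aK]] := coarse alpha N _ N10 XS; first lra.
      exists a; split=> //; apply: le_trans aK.
      (* For alpha >= 1/2 the exponent (alpha + 1)/3 is at most alpha, so the coarse bound
         suffices. *)
      rewrite mulrC mulrA mulr1 ler_pM2r ?invr_gt0// ler_powR//; lra.
    have [a [ac aK]] := fine_lattice_count N0 a2 XS.
    exists a; split=> //; apply: le_trans aK.
    have Y0 := powR_ge0 N%:R ((alpha + 1) / 3) : 0 <= _ :> R.
    by rewrite mulrAC mul1r ler_pdivrMr//; lra.
  have N0 : (0 < N)%N by apply: leq_trans N10.
  have x1 : 1 <= N%:R :> R by rewrite ler1n.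
  have [|a [ac aK]] := coarse alpha N a1 N10.
    rewrite -powR12_sqrt ?ler0n//; apply: (@le_trans _ _ (1 * N%:R `^ 2^-1)).
      by rewrite mul1r ler_powR//; lra.
    by rewrite ler_wpM2r ?powR_ge0.
  by exists a; split=> //; rewrite mulrC mulrA mulr1.
move=> eps eps0; exists 7; split=> // N a alpha N0 ac /andP[a0 a2].
have x1 : 1 <= N%:R :> R by rewrite ler1n.
split=> _.
  apply: le_trans (lattice_count_upper N0 ac _) _; first lra.
  rewrite ler_wpM2r ?powR_ge0// ler_peMr//; apply: ge1_powR_ge1 => //; exact: ltW.
have X1 : 1 <= N%:R `^ alpha :> R by apply: ge1_powR_ge1.
rewrite lattice_count_scaled//.
apply: le_trans (@convex_count_le_length R N a (N%:R `^ alpha) _ ac _ _) _.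
- by rewrite powR_gt0// ltr0n.
- by move=> n /asboolP.
lra.
Qed.
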